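(* Let $p$ be a prime greater than $13$, and let $L$ be a link with $\det L\neq 0$ and $p\mid \det L$. Then $\mathrm{mincol}_p\, L\geq 6$.
   Context: Links are classical links in 3-space, and $\det L$ denotes the determinant of the link $L$. For an integer $m>1$, a (Fox) $m$-coloring of a link diagram is an assignment of elements (''colors'') of $\{0,1,\ldots,m-1\}$ (regarded as $\mathbb{Z}_m$) to the arcs of the diagram such that at each crossing twice the color of the over-arc equals the sum of the colors of the two under-arcs modulo $m$. A coloring is non-trivial if it uses at least two distinct colors. A link is $m$-colorable (admits non-trivial $m$-colorings) if it has a diagram with a non-trivial $m$-coloring (equivalently, every diagram of it has one); this holds if and only if $\det L$ and $m$ are not relatively prime. For an $m$-colorable link $L$ and a diagram $D$ of $L$, let $n_{m,D}$ be the minimum number of distinct colors used by a non-trivial $m$-coloring of $D$. The minimum number of colors of $L$ mod $m$ is $\mathrm{mincol}_m L=\min\{n_{m,D}\mid D \text{ is a diagram of } L\}$. *)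

(* Defs.v *)
From Stdlib Require Import Relations.
From mathcomp Require Import all_boot all_order all_algebra.
From mathcomp Require Import boolp.

Set Implicit Arguments.
Unset Strict Implicit.
Unset Printing Implicit Defensive.

Import GRing.Theory.

(* Quotient of T by the equivalence relation generated by a finite list E of
   pairs: [rep E x] is a representative of the class of x (see repP). *)
Definition merge (T : eqType) (e : T * T) (r : T -> T) : T -> T :=
  let a := r e.1 in let b := r e.2 in fun x => if r x == a then b else r x.

Definition rep (T : eqType) (E : seq (T * T)) : T -> T := foldr (@merge T) id E.

Definition nclasses (T : eqType) (E : seq (T * T)) (s : seq T) : nat :=
  size (undup [seq rep E x | x <- s]).

Lemma repP (T : eqType) (E : seq (T * T)) (x y : T) :
  rep E x = rep E y <-> clos_refl_sym_trans T (fun u v => (u, v) \in E) x y.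
Proof.
split=> [|H]; last first.
  have step : forall u v, (u, v) \in E -> rep E u = rep E v.
    move=> u v; elim: E {H} => //= e E IH; rewrite inE /merge.
    case/predU1P=> [<- /=|/IH -> //].
    by rewrite eqxx; case: ifP.
  by elim: H => // u v w _ -> _ ->.
elim: E x y => [|e E IH] x y /=; first by move=> ->; apply: rst_refl.
have sub u v : clos_refl_sym_trans T (fun a b => (a, b) \in E) u v ->
    clos_refl_sym_trans T (fun a b => (a, b) \in e :: E) u v.
  elim=> {u v} [u v Huv|u|u v _ H|u v w _ H _ H'].
  - by apply: rst_step; rewrite inE Huv orbT.
  - exact: rst_refl.
  - exact: rst_sym.
  - exact: rst_trans H H'.
have He : clos_refl_sym_trans T (fun a b => (a, b) \in e :: E) e.1 e.2.
  by apply: rst_step; rewrite -surjective_pairing mem_head.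
rewrite /merge; case: eqP => [/IH/sub Hx|_]; case: eqP => [/IH/sub Hy|_].
- by move=> _; apply: rst_trans Hx _; apply: rst_sym.
- by move/IH/sub => H; apply: rst_trans Hx _; apply: rst_trans He H.
- move/IH/sub => H; apply: rst_trans H _; apply: rst_sym.
  exact: rst_trans Hy He.
- by move/IH/sub.
Qed.

(* Planar diagram codes.  The edges of the diagram carry labels.
   [Cross a b c d] is a crossing whose four ends, read counterclockwise, lie on
   the edges a, b, c, d; the strand a-c passes under the strand b-d.
   [Joint a b] is a marked point on a strand, where the edge a meets the edge b;
   a component without crossings is represented by a circle through joints,
   e.g. [:: Joint a a].  Marked points carry no other information: they can be
   inserted and removed freely by the moves below. *)
Inductive vertex : Type :=
  | Cross of nat & nat & nat & nat
  | Joint of nat & nat.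

Definition ends (v : vertex) : seq nat :=
  match v with Cross a b c d => [:: a; b; c; d] | Joint a b => [:: a; b] end.

Definition labels (D : seq vertex) : seq nat := flatten [seq ends v | v <- D].

(* Sphericity is expressed by Euler's formula V - E + F = 2C (which holds iff
   every connected component of the underlying graph, with the given cyclic
   orders at the vertices, has genus 0). *)
Definition slots (D : seq vertex) : seq (nat * nat) :=
  [seq (i, k) | i <- iota 0 (size D), k <- iota 0 (size (ends (nth (Joint 0 0) D i)))].

Definition slot_label (D : seq vertex) (s : nat * nat) : nat :=
  nth 0 (ends (nth (Joint 0 0) D s.1)) s.2.

(* The slot (i, k) also names the corner at the i-th vertex between its ends k
   and k+1 (counterclockwise).  If an edge joins the ends (i, k) and (j, l),
   then, walking along it from i to j, its left side bounds the corner (i, k)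
   at the start and the corner (j, l-1) at the end. *)
Definition prev_slot (D : seq vertex) (s : nat * nat) : nat * nat :=
  let n := size (ends (nth (Joint 0 0) D s.1)) in (s.1, (s.2 + n.-1) %% n).

Definition face_pairs (D : seq vertex) : seq ((nat * nat) * (nat * nat)) :=
  [seq (e.1, prev_slot D e.2) |
    e <- [seq (s, t) | s <- slots D, t <- slots D]
    & (e.1 != e.2) && (slot_label D e.1 == slot_label D e.2)].

Definition nfaces (D : seq vertex) : nat := nclasses (face_pairs D) (slots D).

Definition ncomponents (D : seq vertex) : nat :=
  nclasses (flatten [seq [seq (head 0 (ends v), l) | l <- ends v] | v <- D])
           (labels D).

Definition planar (D : seq vertex) : bool :=
  size D + nfaces D == size (undup (labels D)) + (ncomponents D).*2.

Definition well_formed (D : seq vertex) : bool :=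
  (0 < size D) && all (fun l => count_mem l (labels D) == 2) (labels D).

Record diagram : Type := Diagram {
  code :> seq vertex;
  diagramP : well_formed code && planar code }.

(* Elementary local moves.  Each is applied inside a larger code, and both codes
   are required to be diagrams; since every label occurs exactly twice in a
   diagram, the labels occurring on one side only are then automatically
   internal to the tangle displayed. *)
Inductive move : seq vertex -> seq vertex -> Prop :=
  (* changes of presentation *)
  | move_swap v w : move [:: v; w] [:: w; v]
  | move_turn a b c d : move [:: Cross a b c d] [:: Cross c d a b]
  | move_flip a b : move [:: Joint a b] [:: Joint b a]
  (* insertion and deletion of a marked point; with the rules above they also
     generate all renamings of labels *)
  | move_under a b x y z :
      move [:: Joint a b; Cross b x y z] [:: Cross a x y z]
  | move_over a b x y z :
      move [:: Joint a b; Cross x b y z] [:: Cross x a y z]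
  | move_joint a b x : move [:: Joint a b; Joint b x] [:: Joint a x]
  (* first Reidemeister move, for both signs of the kink *)
  | move_R1 a b x : move [:: Cross a b x x] [:: Joint a b]
  | move_R1' a b x : move [:: Cross a x x b] [:: Joint a b]
  (* second Reidemeister move: the strand a-x-c passes under b-y-d *)
  | move_R2 a b c d x y :
      move [:: Cross a b x y; Cross x d c y] [:: Joint a c; Joint b d]
  (* third Reidemeister move: the strand t-t' is over m-m', which is over b-b';
     x, y, z are the sides of the triangle on the strands t, m, b.  The second
     rule is the mirror image of the first in a line of the plane. *)
  | move_R3 t t' m m' b b' x y z :
      move [:: Cross m x y t; Cross b t' z x; Cross z m' b' y]
           [:: Cross y t' m' x; Cross z x b' t; Cross b y z m]
  | move_R3' t t' m m' b b' x y z :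
      move [:: Cross m t y x; Cross b x z t'; Cross z y b' m']
           [:: Cross y x m' t'; Cross z t b' x; Cross b m z y].

Definition step (D D' : diagram) : Prop :=
  exists A B T T', [/\ move T T', D = A ++ T ++ B :> seq vertex
                     & D' = A ++ T' ++ B :> seq vertex].

Definition reidemeister : diagram -> diagram -> Prop :=
  clos_refl_sym_trans diagram step.

(* By Reidemeister's theorem, isotopy classes of links in 3-space correspond to
   Reidemeister classes of diagrams. *)
Record link : Type := Link {
  diagram_of : diagram -> Prop;
  linkP : exists D0, forall D, diagram_of D <-> reidemeister D0 D }.

Lemma link_inhabited (L : link) : exists D, diagram_of L D.
Proof. by case: (linkP L) => D0 H; exists D0; apply/H; apply: rst_refl. Qed.

(* An arc runs from undercrossing to undercrossing: the edges b and d at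
   [Cross a b c d], and the edges at a joint, belong to the same arc.  An arc is
   denoted by the representative of the labels of its edges. *)
Definition arc_pair (v : vertex) : nat * nat :=
  match v with Cross _ b _ d => (b, d) | Joint a b => (a, b) end.

Definition arc (D : seq vertex) : nat -> nat := rep [seq arc_pair v | v <- D].

Definition arcs (D : seq vertex) : seq nat :=
  undup [seq arc D l | l <- labels D].

(* The crossings of D as triples (over-arc, under-arc, under-arc). *)
Definition crossings (D : seq vertex) : seq (nat * nat * nat) :=
  pmap (fun v => if v is Cross a b c _ then Some (arc D b, arc D a, arc D c)
                 else None) D.

(* Only the values of f on [arcs D] are relevant. *)
Definition is_coloring (m : nat) (D : seq vertex) (f : nat -> 'I_m) : Prop :=
  forall o u v, (o, u, v) \in crossings D -> 2 * f o = f u + f v %[mod m].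

Definition colors (m : nat) (D : seq vertex) (f : nat -> 'I_m) : seq 'I_m :=
  undup [seq f x | x <- arcs D].

Definition nontrivial (m : nat) (D : seq vertex) (f : nat -> 'I_m) : Prop :=
  2 <= size (colors D f).

(* The least element of P, and 0 if there is none. *)
Definition least (P : nat -> Prop) : nat :=
  if pselect (exists n, `[< P n >]) is left exP then ex_minn exP else 0.

(* The number n_{m,D}. *)
Definition mincol_diagram (m : nat) (D : seq vertex) : nat :=
  least (fun n => exists f : nat -> 'I_m,
    [/\ is_coloring D f, nontrivial D f & n = size (colors D f)]).

Definition mincol (m : nat) (L : link) : nat :=
  least (fun n => exists2 D : diagram, diagram_of L D & n = mincol_diagram m D).

Local Open Scope ring_scope.

Definition coloring_mx (D : seq vertex) :
    'M[int]_(size (crossings D), size (arcs D)) :=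
  \matrix_(i, j)
    let: (o, u, v) := nth (0, 0, 0)%N (crossings D) i in
    let x := nth 0%N (arcs D) j in
    (o == x)%:R *+ 2 - (u == x)%:R - (v == x)%:R.

(* The minors of order (number of arcs - 1) of the coloring matrix of a diagram
   all have the same absolute value, the determinant of the diagram.  Taking
   their gcd avoids choosing one of them, and gives the right value when there
   are fewer crossings than arcs (some component never passes under): 1 for a
   circle without crossings, and 0 if the matrix has too few rows.  Selections
   f, g that are not injective contribute 0. *)
Definition det_diagram (D : seq vertex) : nat :=
  \big[gcdn/0%N]_(f : {ffun 'I_(size (arcs D)).-1 -> 'I_(size (crossings D))})
  \big[gcdn/0%N]_(g : {ffun 'I_(size (arcs D)).-1 -> 'I_(size (arcs D))})
    `|\det (mxsub f g (coloring_mx D))|%N.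

(* Reidemeister moves do not change det_diagram, so any diagram of L will do. *)
Definition det_link (L : link) : nat :=
  det_diagram (projT1 (cid (link_inhabited L))).

(* Main.v *)
(* Call a code D rigid over a field F when all solutions g : edges -> F of the
   Fox coloring equations 2 g(over) = g(under) + g(under') are constant.  Each
   Reidemeister move transports solutions, so rigidity depends only on the link;
   and since constants always are solutions, D is rigid over F iff some minor of
   order (number of arcs) - 1 of its coloring matrix is nonzero in F.  Hence,
   under the hypotheses, every diagram of L is rigid over Q and not over F_p.
   Given a non-trivial p-coloring with n colors, consider the same equations with
   the n colors as unknowns.  They are rigid over Q, because their solutions pull
   back to solutions on D, but not over F_p, because the colors themselves are a
   solution.  So some minor of order n - 1 is a nonzero integer divisible by p.
   Each of its rows is a sum of two rows of the form e_o - e_u, so that it is a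
   sum of 2^(n-1) minors of incidence matrices, which are 0, 1 or -1, and
   p <= 2^(n-1).  If n <= 5, this
   gives p <= 16. *)
From Stdlib Require Import Relations.
Require Import Defs.
From mathcomp Require Import all_boot all_order all_algebra.
From mathcomp Require Import perm boolp ring zify.

Set Implicit Arguments.
Unset Strict Implicit.
Unset Printing Implicit Defensive.

Import Order.TTheory GRing.Theory Num.Theory.
Local Open Scope ring_scope.

(** * Rank, minors and constant kernels over a field *)

Lemma minor_le_rank (F : fieldType) m n k (A : 'M[F]_(m, n))
    (f : 'I_k -> 'I_m) (g : 'I_k -> 'I_n) :
  \det (mxsub f g A) != 0 -> (k <= \rank A)%N.
Proof.
rewrite -unitfE -unitmxE => /mxrank_unit {1}<-.
have -> : mxsub f g A = rowsub f A *m colsub g 1%:M.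
  by rewrite mulmx_colsub mulmx1 -mxsub_comp.
exact: leq_trans (mxrankM_maxl _ _) (mxrankS (rowsub_sub _ _)).
Qed.

Lemma rank_minor (F : fieldType) m n (A : 'M[F]_(m, n)) :
  exists (f : 'I_(\rank A) -> 'I_m) (g : 'I_(\rank A) -> 'I_n),
    \det (mxsub f g A) != 0.
Proof.
set B := rowsub (maxrankfun A) A.
have fullB : row_full B^T by rewrite -col_leq_rank mxrank_tr row_leq_rank; apply: maxrowsub_free.
exists (maxrankfun A), (fullrankfun fullB).
rewrite -unitfE -unitmxE -unitmx_tr -row_full_unit.
have -> : (mxsub (maxrankfun A) (fullrankfun fullB) A)^T
        = rowsub (fullrankfun fullB) B^T by apply/matrixP=> i j; rewrite !mxE.
exact: fullrowsub_full.
Qed.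

Section ConstantKernel.
Variables (F : fieldType) (m n : nat) (A : 'M[F]_(m, n.+1)).
Hypothesis A1 : A *m const_mx 1 = 0 :> 'cV_m.

Let u : 'rV[F]_n.+1 := const_mx 1.

Let rank_u : \rank u = 1%N.
Proof.
rewrite rank_rV; case: eqP => // /rowP /(_ 0).
by rewrite !mxE => /eqP; rewrite oner_eq0.
Qed.

Let u_ker : (u <= kermx A^T)%MS.
Proof. by apply/sub_kermxP; rewrite -[u]trmxK -trmx_mul trmx_const A1 trmx0. Qed.

Lemma rank_const_kernel : (\rank A <= n)%N.
Proof. by have := mxrankS u_ker; rewrite mxrank_ker mxrank_tr rank_u subn_gt0. Qed.

(** The constants span a line inside the kernel, whose dimension is [n.+1 - \rank A]; comparing
    dimensions decides whether the line is everything. *)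
Lemma const_kernelP :
  \rank A = n <-> forall v : 'cV_n.+1, A *m v = 0 -> exists c, v = const_mx c.
Proof.
split=> [rkA v Av|constA].
  have: (v^T <= u)%MS.
    apply: submx_trans (_ : kermx A^T <= u)%MS.
      by apply/sub_kermxP; rewrite -trmx_mul Av trmx0.
    have [_ <-] := mxrank_leqif_sup u_ker.
    by rewrite mxrank_ker mxrank_tr rkA rank_u subSnn.
  case/sub_rVP=> c vE; exists c; rewrite -[v]trmxK vE.
  by apply/colP=> i; rewrite !mxE mulr1.
apply/eqP; rewrite eqn_leq rank_const_kernel /=.
have: (kermx A^T <= u)%MS.
  apply/rV_subP=> v /sub_kermxP vA; case: (constA v^T).
    by rewrite -[A]trmxK -trmx_mul vA trmx0.
  move=> c vE; apply/sub_rVP; exists c; rewrite -[v]trmxK vE.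
  by apply/rowP=> i; rewrite !mxE mulr1.
by move/mxrankS; rewrite mxrank_ker mxrank_tr rank_u; lia.
Qed.

End ConstantKernel.

(** * Systems of equations 2 h(o) = h(u) + h(v) *)

Section Triples.
Variables (T : eqType) (z0 : T * T * T) (x0 : T) (C : seq (T * T * T)) (S : seq T).

(** With [crossings D] and [arcs D] this is [coloring_mx D]. The type [T] is arbitrary because
    [colors_lower_bound] takes the colors as unknowns. *)
Definition triples_mx : 'M[int]_(size C, size S) :=
  \matrix_(i, j)
    let: (o, u, v) := nth z0 C i in
    let x := nth x0 S j in
    (o == x)%:R *+ 2 - (u == x)%:R - (v == x)%:R.

Definition triples_solution (F : fieldType) (h : T -> F) :=
  forall o u v, (o, u, v) \in C -> h o *+ 2 = h u + h v.

Definition triples_rigid (F : fieldType) :=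
  forall h : T -> F, triples_solution h -> exists c, {in S, forall x, h x = c}.

Hypothesis uniqS : uniq S.
Hypothesis CS : forall o u v, (o, u, v) \in C -> [/\ o \in S, u \in S & v \in S].

Lemma sum_indicator_nth (F : fieldType) (w : T -> F) a : a \in S ->
  \sum_(j < size S) (a == nth x0 S j)%:R * w (nth x0 S j) = w a.
Proof.
move=> aS; have lt_a : (index a S < size S)%N by rewrite index_mem.
rewrite (bigD1 (Ordinal lt_a)) //= nth_index // eqxx mul1r big1 ?addr0 // => j.
rewrite -val_eqE /= => ja; case: eqP => [aE|]; last by rewrite mul0r.
by rewrite aE index_uniq ?eqxx in ja.
Qed.

Lemma triples_mxM (F : fieldType) (h : T -> F) :
  triples_solution h <->
  map_mx intr triples_mx *m (\col_(j < size S) h (nth x0 S j)) = 0.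
Proof.
have entry i o u v : nth z0 C i = (o, u, v) -> (i < size C)%N ->
    forall lti : (i < size C)%N,
    (map_mx intr triples_mx *m (\col_(j < size S) h (nth x0 S j))) (Ordinal lti) 0
      = h o *+ 2 - h u - h v.
  move=> iE lt_i lti; have /CS[oS uS vS] : (o, u, v) \in C by rewrite -iE mem_nth.
  rewrite -(sum_indicator_nth h oS) -(sum_indicator_nth h uS).
  rewrite -(sum_indicator_nth h vS) -sumrMnl -!sumrB mxE.
  apply: eq_bigr => j _; rewrite !mxE /= iE !rmorphB /= rmorphMn /= !rmorph_nat.
  ring.
split=> [sol|ker o u v ouv].
  apply/colP=> -[i lti]; case iE: (nth z0 C i) => [[o u] v].
  by rewrite (entry _ _ _ _ iE) // (sol o u v) ?mxE -?iE ?mem_nth //; ring.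
have lti : (index (o, u, v) C < size C)%N by rewrite index_mem.
have := entry _ _ _ _ (nth_index z0 ouv) lti lti.
rewrite ker mxE => /esym/eqP; rewrite -addrA -opprD subr_eq0 => /eqP.
exact.
Qed.

(** The minors are integers independent of [F]; the field only decides which of them vanish. This is
    what lets [rat] and ['F_p] be compared. *)
Lemma triples_rigidP (F : fieldType) : (0 < size S)%N ->
  triples_rigid F <->
  exists (f : 'I_(size S).-1 -> 'I_(size C)) (g : 'I_(size S).-1 -> 'I_(size S)),
    (\det (mxsub f g triples_mx))%:~R != 0 :> F.
Proof.
move=> S_gt0; set M : 'M[F]__ := map_mx intr triples_mx.
have M1 : M *m const_mx 1 = 0 :> 'cV_(size C).
  have /triples_mxM <- : triples_solution (fun=> 1 : F) by move=> o u v _.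
  by congr (_ *m _); apply/colP=> j; rewrite !mxE.
have detE k (f : 'I_k -> _) g :
    (\det (mxsub f g triples_mx))%:~R = \det (mxsub f g M).
  by rewrite -map_mxsub det_map_mx.
have rigidE : triples_rigid F <->
    forall v : 'cV_(size S), M *m v = 0 -> exists c, v = const_mx c.
  split=> [rig v Mv|ker h /triples_mxM/ker[c hE]].
    (* The vector [v] read as a function on [T], extended by 0 outside [S]. *)
    pose h x := if insub (index x S) is Some j then v j 0 else 0.
    have hv : \col_j h (nth x0 S j) = v.
      apply/colP=> j; by rewrite mxE /h index_uniq // valK.
    have /rig[c hc] : triples_solution h by apply/triples_mxM; rewrite hv.
    exists c; rewrite -hv; apply/colP=> j; rewrite !mxE; apply: hc.
    exact: mem_nth.
  exists c => x xS; have ltx : (index x S < size S)%N by rewrite index_mem.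
  by move/colP/(_ (Ordinal ltx)): hE; rewrite !mxE /= nth_index.
have rankE : triples_rigid F <-> \rank M = (size S).-1.
  apply: (iff_trans rigidE); apply: iff_sym.
  move: M M1 {detE rigidE}; case: (size S) S_gt0 => // n _ M M1.
  exact: const_kernelP.
have rank_le : (\rank M <= (size S).-1)%N.
  move: M M1 {detE rigidE rankE}; case: (size S) S_gt0 => // n _ M M1.
  exact: rank_const_kernel.
rewrite rankE; split=> [rkM|[f [g]]].
  have [f [g]] := rank_minor M; move: f g; rewrite rkM => f g d.
  by exists f, g; rewrite detE.
rewrite detE => /minor_le_rank le_rk; apply/eqP.
by rewrite eqn_leq rank_le.
Qed.

End Triples.

(** * Bounding the minors *)

Lemma det_noninjective_cols (T : eqType) (R : comNzRingType) k (E : 'I_k -> T -> R)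
    (g : 'I_k -> T) :
  ~ injective g -> \det (\matrix_(i, j) E i (g j)) = 0.
Proof.
move/injectiveP/injectivePn=> [j1 [j2 ne12 eq12]].
rewrite -det_tr; apply: (determinant_alternate ne12) => i.
by rewrite !mxE eq12.
Qed.

(* A row with at most one nonzero entry reduces the determinant to a smaller one of
   the same kind; without such rows all row sums vanish. *)
Lemma det_incidence (T : eqType) k (a b g : 'I_k -> T) :
  `|\det (\matrix_(i, j) ((b i == g j)%:R - (a i == g j)%:R) : 'M[int]_k)| <= 1.
Proof.
elim: k => [|k IH] in a b g *; first by rewrite det_mx00.
have [g_inj|/(@det_noninjective_cols _ _ _ (fun i x => (b i == x)%:R - (a i == x)%:R))->] :=
  pselect (injective g); last by rewrite normr0.
(* The number of columns labelled [x], at most 1 by injectivity; row [i] sums to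
   [c (b i) - c (a i)]. *)
pose c (x : T) : int := \sum_j (x == g j)%:R.
have cE x : c x = (x \in codom g)%:R.
  rewrite /c; case: codomP => [[j0 ->]|xg].
    rewrite (bigD1 j0) //= eqxx big1 ?addr0 // => j /negPf ne.
    by rewrite (inj_eq g_inj) eq_sym ne.
  by rewrite big1 // => j _; case: eqP => // xE; case: xg; exists j.
set M := \matrix_(i, j) _.
have single i0 (x : T) (e : int) : `|e| <= 1 ->
    (forall j, M i0 j = e * (x == g j)%:R) -> `|\det M| <= 1.
  move=> le_e Mrow; rewrite (expand_det_row _ i0).
  have bound j : `|cofactor M i0 j| <= 1.
    rewrite /cofactor normrMsign.
    apply: le_trans (IH (a \o lift i0) (b \o lift i0) (g \o lift j)).
    rewrite le_eqVlt; apply/orP; left; apply/eqP; congr `|\det _|.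
    by apply/matrixP=> i l; rewrite !mxE.
  have [/codomP[j0 xE]|xg] := boolP (x \in codom g).
    rewrite (bigD1 j0) //= big1 => [|j /negPf ne].
      by rewrite addr0 normrM Mrow xE eqxx mulr1 mulr_ile1.
    by rewrite Mrow xE (inj_eq g_inj) eq_sym ne mulr0 mul0r.
  rewrite big1 ?normr0 // => j _; rewrite Mrow; case: eqP => [xE|]; last by rewrite mulr0 mul0r.
  by rewrite xE codom_f in xg.
have [/forallP full|/forallPn[i0]] :=
  boolP [forall i, (a i \in codom g) && (b i \in codom g)].
  suff -> : \det M = 0 by rewrite normr0.
  have Mker : M *m const_mx 1 = 0 :> 'cV_k.+1.
    apply/colP=> i; rewrite !mxE.
    under eq_bigr do rewrite !mxE mulr1.
    by rewrite sumrB -/(c _) -/(c _) !cE; case/andP: (full i) => -> ->; rewrite subrr.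
  (* Multiplying [Mker] by the adjugate avoids leaving the integers for a field. *)
  have: \det M *: const_mx 1 = 0 :> 'cV[int]_k.+1.
    by rewrite -mul_scalar_mx -mul_adj_mx -mulmxA Mker mulmx0.
  by move/colP/(_ ord0); rewrite !mxE mulr1.
have entry0 x j : x \notin codom g -> (x == g j) = false.
  by move=> xg; apply: contraNF xg => /eqP ->; apply: codom_f.
rewrite negb_and => /orP[ag|bg].
  by apply: (single i0 (b i0) 1) => // j; rewrite mxE (entry0 (a _)) // subr0 mul1r.
apply: (single i0 (a i0) (-1)) => // j.
by rewrite mxE (entry0 (b _)) // sub0r mulN1r.
Qed.

(** Multilinearity in the rows: distribute the product in each term of the Leibniz formula, [h]
    choosing one summand per row. *)
Lemma det_sum_rows (R : comNzRingType) k (J : finType) (W : J -> 'I_k -> 'I_k -> R) :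
  \det (\matrix_(i, j) \sum_t W t i j)
    = \sum_(h : {ffun 'I_k -> J}) \det (\matrix_(i, j) W (h i) i j).
Proof.
rewrite /determinant exchange_big; apply: eq_bigr => s _.
rewrite -mulr_sumr; congr (_ * _).
rewrite (eq_bigr (fun i => \sum_t W t i (s i))) => [|i _]; last by rewrite mxE.
by rewrite bigA_distr_bigA; apply: eq_bigr => h _; apply: eq_bigr => i _; rewrite mxE.
Qed.

Lemma det_triples (T : eqType) k (o u v g : 'I_k -> T) :
  `|\det (\matrix_(i, j) ((o i == g j)%:R *+ 2 - (u i == g j)%:R - (v i == g j)%:R)
      : 'M[int]_k)| <= (2 ^ k)%:R.
Proof.
pose W (t : bool) i j : int := (o i == g j)%:R - ((if t then u i else v i) == g j)%:R.
have -> : (\matrix_(i, j) ((o i == g j)%:R *+ 2 - (u i == g j)%:R - (v i == g j)%:R))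
    = \matrix_(i, j) \sum_t W t i j.
  by apply/matrixP=> i j; rewrite !mxE big_bool /W /=; ring.
rewrite det_sum_rows; apply: (le_trans (ler_norm_sum _ _ _)).
rewrite (_ : (2 ^ k)%:R = \sum_(h : {ffun 'I_k -> bool}) 1 :> int); last first.
  by rewrite sumr_const card_ffun card_bool card_ord.
apply: ler_sum => h _.
exact: (det_incidence (fun i => if h i then u i else v i) o g).
Qed.

(** * Invariance under Reidemeister moves *)

Section LabelColorings.
Variable R : comNzRingType.
Implicit Types (g : nat -> R) (D : seq vertex).

(* Each equation is solved for one value, so that [subst] applies to a list of them. *)
Definition vertex_ok g (v : vertex) : Prop :=
  match v with
  | Cross a b c d => g d = g b /\ g c = g b *+ 2 - g a
  | Joint a b => g b = g a
  end.

Fixpoint code_ok g D : Prop :=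
  if D is v :: D' then vertex_ok g v /\ code_ok g D' else True.

(** The unknowns are edges rather than arcs: a move may merge or split arcs reaching far outside its
    tangle, whereas it leaves all outer edges alone. *)
Definition rigid D :=
  forall g, code_ok g D -> exists c, {in labels D, forall x, g x = c}.

Lemma code_ok_cat g D D' : code_ok g (D ++ D') <-> code_ok g D /\ code_ok g D'.
Proof. by elim: D => [|v D IH] /=; [tauto | rewrite IH; tauto]. Qed.

Lemma labels_cat D D' : labels (D ++ D') = labels D ++ labels D'.
Proof. by rewrite /labels map_cat flatten_cat. Qed.

Lemma code_ok_eq g g' D : {in labels D, g =1 g'} -> code_ok g D -> code_ok g' D.
Proof.
elim: D => //= v D IH eq_g [vok Dok]; split.
  have eqv x : x \in ends v -> g' x = g x.
    by move=> xv; rewrite -eq_g // /labels /= mem_cat xv.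
  by case: v vok eqv {eq_g} => [a b c d|a b] /= vok eqv;
    rewrite !eqv // !inE eqxx ?orbT.
by apply: IH => // x xD; apply: eq_g; rewrite /labels /= mem_cat xD orbT.
Qed.

Lemma rep_respects (T : eqType) (E : seq (T * T)) (h : T -> R) x :
  {in E, forall e, h e.1 = h e.2} -> h (rep E x) = h x.
Proof.
elim: E x => // e E IH x hE; rewrite /rep /= -/(rep E) /Defs.merge.
have {}IH y : h (rep E y) = h y by apply: IH => e' e'E; apply: hE; rewrite inE e'E orbT.
by case: eqP => [xe|_]; rewrite IH // -hE ?mem_head // -(IH e.1) -xe IH.
Qed.

Lemma code_ok_arc g D x : code_ok g D -> g (Defs.arc D x) = g x.
Proof.
move=> gD; apply: rep_respects => e; elim: D gD => //= v D IH [gv gD].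
rewrite inE => /predU1P[->|/IH]; last exact.
by case: v gv => [a b c d []|a b] /= ->.
Qed.

Definition two_ends D := {in labels D, forall x, count_mem x (labels D) = 2%N}.

(** Shows that an edge with both ends in the tangle of a move is internal to it, so that its value
    can be changed freely. *)
Lemma fresh_label D x s : two_ends D -> perm_eq (labels D) (x :: x :: s) -> x \notin s.
Proof.
move=> D2 Ds; have : x \in labels D by rewrite (perm_mem Ds) mem_head.
move/D2; have /seq.permP -> := Ds; rewrite /= eqxx => -[xs].
by apply/count_memPn.
Qed.

(* Rigidity of T ++ C up to reordering, where T is the tangle changed by a move and
   C the rest of the diagram. *)
Definition rigid_mid (T C : seq vertex) :=
  forall g, code_ok g T -> code_ok g C ->
  exists c, {in labels T ++ labels C, forall x, g x = c}.

Lemma rigid_midP A T B : rigid (A ++ T ++ B) <-> rigid_mid T (A ++ B).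
Proof.
have okE g : code_ok g (A ++ T ++ B) <-> code_ok g T /\ code_ok g (A ++ B).
  by rewrite !code_ok_cat; tauto.
have labE : labels (A ++ T ++ B) =i labels T ++ labels (A ++ B).
  by move=> x; rewrite !labels_cat !mem_cat orbCA.
split=> rig g => [gT gAB | /okE[gT gAB]].
  have [|c cP] := rig g; first exact/okE.
  by exists c => x; rewrite -labE; apply: cP.
have [c cP] := rig g gT gAB.
by exists c => x; rewrite labE; apply: cP.
Qed.

(** A recursive form of constancy, which computes to a conjunction of equations on the concrete
    tangles of the moves. *)
Fixpoint const_on g (c : R) (s : seq nat) : Prop :=
  if s is x :: s' then g x = c /\ const_on g c s' else True.

Lemma const_onP g c s : const_on g c s <-> {in s, forall x, g x = c}.
Proof.
elim: s => //= x s ->; split=> [[gx gs] y|gs].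
  by rewrite inE => /predU1P[-> //|/gs].
by split=> [|y ys]; apply: gs; rewrite inE ?eqxx ?ys ?orbT.
Qed.

(** [F] recolors the internal edges of the tangle. The last hypothesis handles edges of [T] absent
    from [T']: their values must be recovered from the others. *)
Lemma rigid_mid_transfer (T T' C : seq vertex) (F : (nat -> R) -> nat -> R) :
  (forall g, {in labels C, g =1 F g}) ->
  (forall g, code_ok g T -> code_ok (F g) T') ->
  (forall g c, code_ok g T -> const_on (F g) c (labels T') -> const_on g c (labels T)) ->
  rigid_mid T' C -> rigid_mid T C.
Proof.
move=> FC okF constF rig g gT gC.
have [c cP] := rig _ (okF g gT) (code_ok_eq (FC g) gC).
exists c => x; rewrite mem_cat => /orP[|xC].
  move: x; apply/const_onP/constF => //; apply/const_onP => y yT'.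
  by apply: cP; rewrite mem_cat yT'.
by rewrite FC // cP // mem_cat xC orbT.
Qed.

Definition upd (x : nat) (e : R) g : nat -> R := fun y => if y == x then e else g y.

(** Reduces a linear consequence of a hypothesis [l = r] to an identity for [ring]. *)
Lemma eq_of_sub_eq (l r u v : R) : l = r -> u - v = l - r -> u = v.
Proof. by move=> ->; rewrite subrr => /subr0_eq. Qed.

(** [s] lists, with multiplicity, what remains after removing two copies of [x]; the permutation is
    checked by counting. *)
Ltac get_fresh H x s :=
  have: x \notin s; [
    apply: H; apply/seq.permP=> P; rewrite ?count_cat /= ?count_cat; clear; lia |
    rewrite ?mem_cat ?inE ?negb_or; repeat (move/andP=> []; move=> ?); move=> ? ].

Ltac eval_upd :=
  rewrite /upd ?eqxx;
  repeat match goal with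
  | H : is_true (?x != ?l) |- context [?l == ?x] => rewrite [l == x]eq_sym (negPf H)
  | H : is_true (?x != ?l) |- context [?x == ?l] => rewrite (negPf H)
  end.

Ltac solve_values :=
  repeat match goal with
  | |- context [?h ?l] => is_var h; match type of h with nat -> _ => generalize (h l) end
  end;
  intros; intuition; subst;
  first [ ring
        | match goal with E : _ = _ |- _ =>
            first [apply: (eq_of_sub_eq E); ring | apply: (eq_of_sub_eq (esym E)); ring]
          end].

Ltac transfer F :=
  apply: (@rigid_mid_transfer _ _ _ F) => [?|?|? ?] /=;
  [ let l := fresh in let lC := fresh in
    move=> l lC; rewrite /upd;
    repeat (case: eqP => [?|_];
      [by subst l; match goal with H : is_true (_ \notin _) |- _ => rewrite lC in H end | ]); by []
  | eval_upd; solve_values | eval_upd; solve_values ].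

(** The outer edges force the values of the internal ones, so solutions extend uniquely across a
    move. Freshness is asked of [T] only, since every label of [T'] occurs in [T]. *)
Lemma rigid_mid_move T T' C : move T T' ->
  (forall x s, perm_eq (labels T ++ labels C) (x :: x :: s) -> x \notin s) ->
  rigid_mid T C <-> rigid_mid T' C.
Proof.
case=> {T T'} => [v w|a b c d|a b|a b x y z|a b x y z|a b x|a b x|a b x|a b c d x y
  |t t' m m' b b' x y z|t t' m m' b b' x y z]; move=> H.
- have gv g c s1 s2 : const_on g c (s1 ++ s2) <-> const_on g c (s2 ++ s1).
    by rewrite !const_onP; split=> h x; rewrite mem_cat orbC -mem_cat; apply: h.
  have lab u1 u2 : labels [:: u1; u2] = ends u1 ++ ends u2 by rewrite /labels /= cats0.
  split; apply: (rigid_mid_transfer (F := id)) => [//|g /=|g c _]; try tauto.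
    by rewrite !lab gv.
  by rewrite !lab gv.
- split; transfer (fun g : nat -> R => g) => //.
- split; transfer (fun g : nat -> R => g) => //.
- get_fresh H b (a :: x :: y :: z :: labels C).
  split; [transfer (fun g : nat -> R => upd b (g a) g) | transfer (fun g : nat -> R => g)].
- get_fresh H b (a :: x :: y :: z :: labels C).
  split; [transfer (fun g : nat -> R => upd b (g a) g) | transfer (fun g : nat -> R => g)].
- get_fresh H b (a :: x :: labels C).
  split; [transfer (fun g : nat -> R => upd b (g a) g) | transfer (fun g : nat -> R => g)].
- get_fresh H x (a :: b :: labels C).
  split; [transfer (fun g : nat -> R => upd x (g a) g) | transfer (fun g : nat -> R => g)].
- get_fresh H x (a :: b :: labels C).
  split; [transfer (fun g : nat -> R => upd x (g a) g) | transfer (fun g : nat -> R => g)].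
- get_fresh H x (a :: b :: c :: d :: y :: y :: labels C).
  get_fresh H y (a :: b :: c :: d :: x :: x :: labels C).
  split; [transfer (fun g : nat -> R => upd y (g b) (upd x (g b *+ 2 - g a) g))
         |transfer (fun g : nat -> R => g)].
- get_fresh H x (t :: t' :: m :: m' :: b :: b' :: y :: y :: z :: z :: labels C).
  get_fresh H y (t :: t' :: m :: m' :: b :: b' :: x :: x :: z :: z :: labels C).
  get_fresh H z (t :: t' :: m :: m' :: b :: b' :: x :: x :: y :: y :: labels C).
  split.
    (* Before the move, [m] and [b] reach the triangle by passing under [t]; after it, [y] continues
       [m], and [z] is [b] after passing under [m]. *)
    transfer (fun g : nat -> R => upd x (g t) (upd y (g t *+ 2 - g m) (upd z (g t *+ 2 - g b) g))).
  transfer (fun g : nat -> R => upd x (g t) (upd y (g m) (upd z (g m *+ 2 - g b) g))).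
- get_fresh H x (t :: t' :: m :: m' :: b :: b' :: y :: y :: z :: z :: labels C).
  get_fresh H y (t :: t' :: m :: m' :: b :: b' :: x :: x :: z :: z :: labels C).
  get_fresh H z (t :: t' :: m :: m' :: b :: b' :: x :: x :: y :: y :: labels C).
  split.
    transfer (fun g : nat -> R => upd x (g t) (upd y (g t *+ 2 - g m) (upd z (g t *+ 2 - g b) g))).
  transfer (fun g : nat -> R => upd x (g t) (upd y (g m) (upd z (g m *+ 2 - g b) g))).
Qed.

Lemma rigid_step (D D' : diagram) : step D D' -> rigid D <-> rigid D'.
Proof.
have wf (E : diagram) : two_ends E.
  case: E => E /=; rewrite /well_formed => /andP[/andP[_ /allP E2] _] x xE.
  exact/eqP/E2.
have fresh (E : diagram) A T B : E = A ++ T ++ B :> seq vertex ->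
    forall x s, perm_eq (labels T ++ labels (A ++ B)) (x :: x :: s) -> x \notin s.
  move=> eqE x s Hs; apply: fresh_label (wf E) _; apply: perm_trans Hs.
  by rewrite eqE !labels_cat perm_catCA.
move=> [A [B [T [T' [mv eqD eqD']]]]].
rewrite eqD eqD' !rigid_midP; exact: rigid_mid_move mv (fresh _ _ _ _ eqD).
Qed.

Lemma rigid_reidemeister (D D' : diagram) : reidemeister D D' -> rigid D <-> rigid D'.
Proof.
elim=> {D D'} [D D' /rigid_step //|//|D D' _ <- //|D D' D'' _ -> _ -> //].
Qed.

End LabelColorings.

(** * Colorings and minors *)

(** [crossings D] is the case where [alpha] is the arc map of [D]. That map depends on the whole
    code, so it is held fixed during inductions on [D]. *)
Definition crossings_by (alpha : nat -> nat) (D : seq vertex) : seq (nat * nat * nat) :=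
  pmap (fun v => if v is Cross a b c _ then Some (alpha b, alpha a, alpha c) else None) D.

Lemma code_ok_crossings (F : fieldType) (alpha : nat -> nat) (h : nat -> F) D :
  {in [seq arc_pair v | v <- D], forall e, alpha e.1 = alpha e.2} ->
  code_ok (h \o alpha) D <-> triples_solution (crossings_by alpha D) h.
Proof.
elim: D => // v D IH alphaD.
have /IH{}IH : {in [seq arc_pair v | v <- D], forall e, alpha e.1 = alpha e.2}.
  by move=> e eD; apply: alphaD; rewrite inE eD orbT.
have := alphaD _ (mem_head _ _); case: v {alphaD} => [a b c d|a b] /= eqv; rewrite IH.
  rewrite /triples_solution /= eqv; split=> [[[_ hc] sol] o u v|sol].
    by rewrite inE => /predU1P[[-> -> ->]|/sol //]; rewrite hc addrC subrK.
  split=> [|o u v ouv]; last by apply: sol; rewrite inE ouv orbT.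
  by split=> //; rewrite (sol _ _ _ (mem_head _ _)) addrC addKr.
by rewrite eqv; tauto.
Qed.

Lemma arc_pair_eq D : {in [seq arc_pair v | v <- D],
  forall e, Defs.arc D e.1 = Defs.arc D e.2}.
Proof. by move=> [a b] eD; apply/repP; apply: rst_step. Qed.

Lemma crossings_arcs D o u v : (o, u, v) \in crossings D ->
  [/\ o \in arcs D, u \in arcs D & v \in arcs D].
Proof.
rewrite /arcs !mem_undup /crossings; move: (Defs.arc D) => alpha.
elim: D => //= w D IH; rewrite /labels /= map_cat !mem_cat.
have IH' : (o, u, v) \in crossings_by alpha D -> [/\ o \in [seq alpha l | l <- labels D],
   u \in [seq alpha l | l <- labels D] & v \in [seq alpha l | l <- labels D]] by exact: IH.
case: w => [a b c d|a b] /=; last by move/IH'=> [-> -> ->]; rewrite !orbT.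
rewrite inE => /predU1P[[-> -> ->]|/IH'[-> -> ->]]; last by rewrite !orbT.
by rewrite !inE !eqxx ?orbT.
Qed.

Lemma rigid_triples (F : fieldType) D :
  rigid F D <-> triples_rigid (crossings D) (arcs D) F.
Proof.
split=> rig g gD.
  have [|c cP] := rig (g \o Defs.arc D).
    exact/(code_ok_crossings _ (@arc_pair_eq D)).
  by exists c => x; rewrite mem_undup => /mapP[l lD ->]; apply: cP.
have gE : g =1 g \o Defs.arc D by move=> x; rewrite /= code_ok_arc.
have [|c cP] := rig g.
  by apply/(code_ok_crossings _ (@arc_pair_eq D)); apply: code_ok_eq gD => x _.
by exists c => x xD; rewrite gE; apply: cP; rewrite mem_undup map_f.
Qed.

Lemma arcs_gt0 (D : diagram) : (0 < size (arcs D))%N.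
Proof.
case: D => D /=; rewrite /well_formed => /andP[/andP[D_gt0 _] _].
have [l lD] : exists l, l \in labels D.
  case: D D_gt0 => // -[a b c d|a b] D _; exists a; exact: mem_head.
have : Defs.arc D l \in arcs D by rewrite mem_undup map_f.
by case: (arcs D).
Qed.

(** [d] is the characteristic of [F], and [d] divides a gcd exactly when it divides each minor. For
    [d = 0] divisibility means vanishing, which covers [rat]. *)
Lemma det_diagram_rigid (F : fieldType) d (D : diagram) :
  (forall z : int, (z%:~R == 0 :> F) = (d %| `|z|)%N) ->
  rigid F D <-> ~~ (d %| det_diagram D)%N.
Proof.
move=> dF; rewrite rigid_triples.
rewrite (triples_rigidP (0, 0, 0)%N 0%N (undup_uniq _) (@crossings_arcs D)) ?arcs_gt0 //.
split=> [[f [g]]|ndvd].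
  rewrite dF; apply: contra => /dvdn_biggcdP/(_ (finfun f) isT).
  move=> /dvdn_biggcdP/(_ (finfun g) isT).
  suff -> : mxsub (finfun f) (finfun g) (coloring_mx D)
    = mxsub f g (triples_mx (0, 0, 0)%N 0%N (crossings D) (arcs D)) by [].
  by apply/matrixP=> i j; rewrite !mxE !ffunE.
apply: contrapT => no; case/negP: ndvd.
apply/dvdn_biggcdP=> f _; apply/dvdn_biggcdP=> g _.
rewrite -dF; apply/negPn/negP=> nz; apply: no.
by exists f, g.
Qed.

(** * Colorings modulo a prime *)

Lemma Fp_eq_modP p m n : prime p -> (m%:R = n%:R :> 'F_p) <-> m = n %[mod p].
Proof.
move=> p_pr; split=> [/(congr1 val)|eq_mn]; first by rewrite /= !val_Fp_nat.
by apply: val_inj; rewrite /= !val_Fp_nat.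
Qed.

Lemma least_spec (P : nat -> Prop) : (exists n, P n) -> P (least P).
Proof.
move=> [n Pn]; rewrite /least; case: pselect => [exP|[]]; last by exists n; apply/asboolP.
by case: ex_minnP => k /asboolP.
Qed.

Section FoxColorings.
Variable (p : nat).
Hypothesis p_pr : prime p.

Lemma coloring_triples D (f : nat -> 'I_p) :
  is_coloring D f <-> triples_solution (crossings D) (fun x => (f x)%:R : 'F_p).
Proof.
have eqm o u v : (2 * f o = f u + f v %[mod p])%N <->
    (f o)%:R *+ 2 = (f u)%:R + (f v)%:R :> 'F_p.
  by rewrite -mulr_natl -natrM -natrD Fp_eq_modP.
by split=> col o u v /col /eqm.
Qed.

Lemma exists_coloring (D : diagram) : ~ rigid 'F_p D ->
  exists f : nat -> 'I_p, is_coloring D f /\ nontrivial D f.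
Proof.
move=> nrig; apply: contrapT => nocol; apply: nrig.
apply/rigid_triples => h hD.
(* The reduction changes no value; it only converts from ['F_p] to ['I_p]. *)
pose f x := Ordinal (ltn_pmod (h x) (prime_gt0 p_pr)).
have fE x : (f x)%:R = h x.
  by rewrite -[RHS]natr_Zp; apply/(Fp_eq_modP _ _ p_pr); rewrite /= modn_mod.
have f_triv : ~ nontrivial D f.
  move=> f_nt; apply: nocol; exists f; split=> //.
  by apply/coloring_triples => o u v /hD; rewrite !fE.
have [x0 x0D] : exists x, x \in arcs D.
  by case: (arcs D) (arcs_gt0 D) => // x s _; exists x; apply: mem_head.
exists (h x0) => x xD; rewrite -!fE; congr (nat_of_ord _)%:R.
apply: contrapT => ne; apply: f_triv; rewrite /nontrivial.
apply: (@uniq_leq_size _ [:: f x; f x0]).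
  by rewrite /= inE andbT; apply/eqP.
by move=> y; rewrite !inE mem_undup => /orP[]/eqP ->; apply: map_f.
Qed.

Lemma colors_lower_bound D (f : nat -> 'I_p) :
  rigid rat D -> is_coloring D f -> nontrivial D f ->
  (p <= 2 ^ (size (colors D f)).-1)%N.
Proof.
move=> /rigid_triples rigD fD; rewrite /nontrivial.
set S := colors D f => S_ge2.
pose C := [seq (f t.1.1, f t.1.2, f t.2) | t <- crossings D].
have S_gt0 : (0 < size S)%N by apply: ltnW.
have uniqS : uniq S by apply: undup_uniq.
have arcS x : x \in arcs D -> f x \in S by move=> xD; rewrite mem_undup map_f.
have CS o u v : (o, u, v) \in C -> [/\ o \in S, u \in S & v \in S].
  move=> /mapP[[[o' u'] v'] /crossings_arcs[oD uD vD] [-> -> ->]].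
  by split; apply: arcS.
have x0 : 'I_p by case: (S) S_gt0.
have rigidP F := triples_rigidP (x0, x0, x0) x0 uniqS CS F S_gt0.
have /rigidP[a [b det_nz]] : triples_rigid C S rat.
  move=> h hC; have [|c cP] := rigD (h \o f).
    by move=> o u v ouv; apply: hC; apply/mapP; exists (o, u, v).
  by exists c => x; rewrite mem_undup => /mapP[y yD ->]; apply: cP.
have nrigF : ~ triples_rigid C S 'F_p.
  move=> /(_ (fun x => x%:R))[|c cP].
    move=> o u v /mapP[[[o' u'] v'] ouv [-> -> ->]].
    by move/coloring_triples: fD => /(_ _ _ _ ouv).
  move: S_ge2 uniqS cP; case: (S) => [|x [|y s]] //= _ /andP[xs _] cP.
  have /(Fp_eq_modP _ _ p_pr) : x%:R = y%:R :> 'F_p.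
    by rewrite !cP // !inE eqxx ?orbT.
  rewrite !modn_small // => /val_inj xy.
  by rewrite xy mem_head in xs.
set M := mxsub a b _ in det_nz.
have p_dvd : (p %| `|\det M|)%N.
  rewrite -[(_ %| _)%N]/(p %| \det M)%Z (dvdz_pcharf (pchar_Fp p_pr)).
  (* If [p] did not divide it, this very minor would make the system rigid over ['F_p]. *)
  apply/negPn/negP => nz; apply: nrigF; apply/rigidP.
  by exists a, b.
have det_le : `|\det M| <= (2 ^ (size S).-1)%:R.
  pose t i := nth (x0, x0, x0) C (a i).
  apply: le_trans (det_triples (fun i => (t i).1.1) (fun i => (t i).1.2)
    (fun i => (t i).2) (fun j => nth x0 S (b j))).
  rewrite le_eqVlt; apply/orP; left; apply/eqP; congr `|\det _|.
  by apply/matrixP=> i j; rewrite !mxE /t; case: nth => [[]].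
have det_gt0 : (0 < `|\det M|)%N by rewrite absz_gt0 -(intr_eq0 rat).
apply: leq_trans (dvdn_leq det_gt0 p_dvd) _.
by move: det_le; rewrite -abszE natz lez_nat.
Qed.

End FoxColorings.

Local Close Scope ring_scope.

Theorem theorem3 (p : nat) (L : link) :
  prime p -> 13 < p -> det_link L != 0 -> p %| det_link L -> 6 <= mincol p L.
Proof.
move=> p_pr p_gt13 det_nz p_dvd.
rewrite /det_link in det_nz p_dvd.
case: cid det_nz p_dvd => D0 /= LD0 det_nz p_dvd.
have reid D : diagram_of L D -> reidemeister D0 D.
  case: (linkP L) => D1 LE /LE LD; move/LE: LD0 => LD0.
  exact: rst_trans (rst_sym _ _ _ _ LD0) LD.
have rigQ : rigid rat D0.
  apply/(det_diagram_rigid (d := 0)); last by rewrite dvd0n.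
  by move=> z; rewrite intr_eq0 dvd0n absz_eq0.
have nrigF : ~ rigid 'F_p D0.
  move/(det_diagram_rigid (d := p)); rewrite p_dvd => H.
  suff: false by [].
  apply: H => z; rewrite -(dvdz_pcharf (pchar_Fp p_pr)).
  by rewrite /dvdz.
(* [least] is 0 on an empty predicate, so a single diagram without non-trivial
   colorings would make [mincol p L] zero. *)
have [D LD ->] : exists2 D, diagram_of L D & mincol p L = mincol_diagram p D.
  by apply: (@least_spec (fun n => exists2 D, _ & n = _)); exists (mincol_diagram p D0), D0.
have [f [fD f_nt ->]] : exists f : nat -> 'I_p,
    [/\ is_coloring D f, nontrivial D f & mincol_diagram p D = size (colors D f)].
  apply: (@least_spec (fun n => exists f, [/\ _, _ & n = _])).
  have [|f [fD f_nt]] := @exists_coloring p p_pr D.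
    by rewrite -(rigid_reidemeister _ (reid D LD)).
  by exists (size (colors D f)), f.
have rigQD : rigid rat D by rewrite -(rigid_reidemeister _ (reid D LD)).
rewrite leqNgt ltnS; apply/negP => le5.
have p_le16 : p <= 2 ^ 4.
  apply: leq_trans (colors_lower_bound p_pr rigQD fD f_nt) _.
  by rewrite leq_exp2l //; lia.
(* No prime lies strictly between 13 and 17, so the bound 16 suffices. *)
have : p \in [:: 14; 15; 16] by rewrite !inE; move: p_le16; lia.
by rewrite !inE => /or3P[]/eqP pE; rewrite pE in p_pr.
Qed.
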